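(* Let $\alpha:I\to\mathbb{R}^3$ and $\beta:J\to\mathbb{R}^3$ be polygonal lines, where $I,J\subset\mathbb{Z}$ are intervals of integers, satisfying the genericity hypothesis (G) and the hypothesis (H) described in the context. Consider the discrete indefinite affine minimal surface (DIAMS) $f$ with Lelieuvre normal $\nu(u,v)=\alpha(u)-\beta(v)$. Then the singular set of the DIAMS is a polygonal line, i.e., each singular vertex $(u_0,v_0)$ (with $u_0\pm1\in I$, $v_0\pm1\in J$) is adjacent to exactly two singular edges.
   Context: A DIAMS is a map $f:I\times J\to\mathbb{R}^3$ satisfying the discrete Lelieuvre equations $f(u+1,v)-f(u,v)=\nu(u,v)\times(\nu(u+1,v)-\nu(u,v))$ and $f(u,v+1)-f(u,v)=-\nu(u,v)\times(\nu(u,v+1)-\nu(u,v))$, where $\nu(u,v)=\alpha(u)-\beta(v)$. Write $\alpha'(u+\tfrac12)=\alpha(u+1)-\alpha(u)$ and $\beta'(v+\tfrac12)=\beta(v+1)-\beta(v)$. On each quadrangle, the discrete metric is the number $$\Omega(u+\tfrac12,v+\tfrac12)=[\alpha(u)-\beta(v),\ \alpha'(u+\tfrac12),\ \beta'(v+\tfrac12)],$$ where $[\cdot,\cdot,\cdot]$ is the determinant in $\mathbb{R}^3$. Edges: $(u,v\pm\tfrac12)$ denotes the edge joining $(u,v)$ and $(u,v\pm1)$; $(u\pm\tfrac12,v)$ denotes the edge joining $(u,v)$ and $(u\pm1,v)$. An edge $(u_0,v_0+\tfrac12)$ is singular if $\Omega(u_0-\tfrac12,v_0+\tfrac12)\cdot\Omega(u_0+\tfrac12,v_0+\tfrac12)<0$;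 an edge $(u_0+\tfrac12,v_0)$ is singular if $\Omega(u_0+\tfrac12,v_0-\tfrac12)\cdot\Omega(u_0+\tfrac12,v_0+\tfrac12)<0$. A vertex adjacent to (i.e. an endpoint of) a singular edge is a singular vertex. The singular set is the union of the singular edges and singular vertices. Hypothesis (G): for every $(u,v)\in I\times J$, $\alpha(u)\ne\beta(v)$, and the four planes determined by the line through $\alpha(u),\beta(v)$ together with, respectively, the points $\alpha(u+1),\alpha(u-1),\beta(v+1),\beta(v-1)$ are well defined and distinct (whenever these points exist). For a vertex $(u_0,v_0)$, let $\pi$ be a plane transversal to $\alpha(u_0)-\beta(v_0)$, let $P$ be the projection on $\pi$ parallel to $\alpha(u_0)-\beta(v_0)$, and take the common point $P\alpha(u_0)=P\beta(v_0)$ as origin of $\pi$. Hypothesis (H): for each vertex $(u_0,v_0)$ with $u_0\pm1\in I$, $v_0\pm1\in J$: if the edge $(u_0,v_0+\tfrac12)$ is singular, then $P\beta(v_0-1)$ does not lie in the same quadrant as $P\beta(v_0+1)$, where the quadrants are the four open sectors into which $\pi$ is divided by the two lines through the origin parallel to $P\alpha'(u_0+\tfrac12)$ and $P\alpha'(u_0-\tfrac12)$. The analogous condition is assumed when one starts from any of the other edges at $(u_0,v_0)$: if $(u_0,v_0-\tfrac12)$ is singular the same condition is required, and if $(u_0+\tfrac12,v_0)$ or $(u_0-\tfrac12,v_0)$ is singular, then $P\alpha(u_0+1)$ and $P\alpha(u_0-1)$ do not lie in the same one of the four open sectors determined by the lines through the origin parallel to $P\beta'(v_0+\tfrac12)$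 and $P\beta'(v_0-\tfrac12)$. *)

(* Defs.v *)
From HB Require Import structures.
From mathcomp Require Import all_boot all_order all_algebra.
From mathcomp Require Import classical_sets reals.

Set Implicit Arguments.
Unset Strict Implicit.
Unset Printing Implicit Defensive.

Import Order.TTheory GRing.Theory Num.Theory.

Local Open Scope classical_set_scope.
Local Open Scope ring_scope.

(* Conventions.  An interval of integers is an element of [interval int].
   A polygonal line I -> R^3 is a function on int of which only the values on I
   are ever used.  A half-integer k + 1/2 is represented by the integer k: thus
   [diff a k] is a'(k + 1/2) and [Omega a b u v] is Omega(u + 1/2, v + 1/2). *)

Section Space.
Variable R : realType.
Implicit Types a b c p q r x y : 'rV[R]_3.

Definition det3 a b c : R := \det (\matrix_(i < 3) [:: a; b; c]`_i).

Definition cross a b : 'rV[R]_3 := \row_(k < 3) det3 (delta_mx 0 k) a b.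

Definition plane_dir p q r : {vspace 'rV[R]_3} := <<[:: q - p; r - p]>>%VS.

(* The points p, q, r are not collinear. *)
Definition plane_defined p q r : Prop := free [:: q - p; r - p].

Definition plane_through p q r : set 'rV[R]_3 :=
  [set x | x - p \in plane_dir p q r].

(* For linearly independent d1, d2 these are, as e1 and e2 vary, the four open
   sectors cut out by the lines through the origin parallel to d1 and to d2. *)
Definition quadrant (d1 d2 : 'rV[R]_3) (e1 e2 : bool) : set 'rV[R]_3 :=
  [set x | exists s t : R,
     [/\ 0 < s, 0 < t & x = ((-1) ^+ e1 * s) *: d1 + ((-1) ^+ e2 * t) *: d2]].

Definition same_quadrant (d1 d2 x y : 'rV[R]_3) : Prop :=
  exists e1 e2 : bool, quadrant d1 d2 e1 e2 x /\ quadrant d1 d2 e1 e2 y.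

End Space.

(* [UEdge u v] is the edge (u + 1/2, v) and [VEdge u v] the edge (u, v + 1/2). *)
Inductive edge : Type :=
| UEdge of int & int
| VEdge of int & int.

Definition endpoint (e : edge) (u v : int) : Prop :=
  match e with
  | UEdge u0 v0 => (u = u0 \/ u = u0 + 1) /\ v = v0
  | VEdge u0 v0 => u = u0 /\ (v = v0 \/ v = v0 + 1)
  end.

Inductive neighbour : Type := AlphaNext | AlphaPrev | BetaNext | BetaPrev.

Section DIAMS.
Variable R : realType.
Variables I J : interval int.
Variables alpha beta : int -> 'rV[R]_3.
Implicit Types u v : int.

Definition nu u v : 'rV[R]_3 := alpha u - beta v.

Definition diff (a : int -> 'rV[R]_3) (k : int) : 'rV[R]_3 := a (k + 1) - a k.

Definition is_DIAMS (f : int -> int -> 'rV[R]_3) : Prop :=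
  (forall u v, u \in I -> u + 1 \in I -> v \in J ->
     f (u + 1) v - f u v = cross (nu u v) (nu (u + 1) v - nu u v)) /\
  (forall u v, u \in I -> v \in J -> v + 1 \in J ->
     f u (v + 1) - f u v = - cross (nu u v) (nu u (v + 1) - nu u v)).

Definition Omega u v : R := det3 (alpha u - beta v) (diff alpha u) (diff beta v).

(* The quadrangle with vertices (u, v), (u+1, v), (u, v+1), (u+1, v+1). *)
Definition is_quad u v : bool :=
  [&& u \in I, u + 1 \in I, v \in J & v + 1 \in J].

(* Only edges with a quadrangle on both sides can be singular: otherwise one of
   the two values of Omega in the definition does not exist. *)
Definition singular_edge (e : edge) : Prop :=
  match e with
  | VEdge u v =>
      [/\ is_quad (u - 1) v, is_quad u v & Omega (u - 1) v * Omega u v < 0]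
  | UEdge u v =>
      [/\ is_quad u (v - 1), is_quad u v & Omega u (v - 1) * Omega u v < 0]
  end.

Definition singular_vertex u v : Prop :=
  exists e, singular_edge e /\ endpoint e u v.

Definition inner_vertex u v : bool :=
  [&& u - 1 \in I, u + 1 \in I, v - 1 \in J & v + 1 \in J].

Definition neighbour_exists u v (k : neighbour) : bool :=
  match k with
  | AlphaNext => u + 1 \in I
  | AlphaPrev => u - 1 \in I
  | BetaNext => v + 1 \in J
  | BetaPrev => v - 1 \in J
  end.

Definition neighbour_point u v (k : neighbour) : 'rV[R]_3 :=
  match k with
  | AlphaNext => alpha (u + 1)
  | AlphaPrev => alpha (u - 1)
  | BetaNext => beta (v + 1)
  | BetaPrev => beta (v - 1)
  end.

Definition hypG : Prop :=
  forall u v, u \in I -> v \in J ->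
    [/\ alpha u <> beta v,
        forall k, neighbour_exists u v k ->
          plane_defined (alpha u) (beta v) (neighbour_point u v k)
      & forall k l, neighbour_exists u v k -> neighbour_exists u v l -> k <> l ->
          plane_through (alpha u) (beta v) (neighbour_point u v k) <>
          plane_through (alpha u) (beta v) (neighbour_point u v l)].

(* W is the direction of a plane pi transversal to alpha(u) - beta(v). *)
Definition transversal_plane (W : {vspace 'rV[R]_3}) u v : Prop :=
  \dim W = 2 /\ nu u v \notin W.

(* The linear projection onto W parallel to nu(u,v): the action of P on vectors
   such as alpha'(u + 1/2). *)
Definition projv_nu (W : {vspace 'rV[R]_3}) u v (x : 'rV[R]_3) : 'rV[R]_3 :=
  daddv_pi W <[nu u v]>%VS x.

(* The action of P on points.  Taking P alpha(u) = P beta(v) as origin identifies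
   pi with its direction W, whatever the translate of W that pi is. *)
Definition projp_nu (W : {vspace 'rV[R]_3}) u v (x : 'rV[R]_3) : 'rV[R]_3 :=
  projv_nu W u v (x - alpha u).

(* [pi u v] is the direction of the plane chosen at the vertex (u, v). *)
Definition hypH (pi : int -> int -> {vspace 'rV[R]_3}) : Prop :=
  forall u v, inner_vertex u v ->
    let Pv := projv_nu (pi u v) u v in
    let Pp := projp_nu (pi u v) u v in
    (singular_edge (VEdge u v) \/ singular_edge (VEdge u (v - 1)) ->
       ~ same_quadrant (Pv (diff alpha u)) (Pv (diff alpha (u - 1)))
           (Pp (beta (v - 1))) (Pp (beta (v + 1)))) /\
    (singular_edge (UEdge u v) \/ singular_edge (UEdge (u - 1) v) ->
       ~ same_quadrant (Pv (diff beta v)) (Pv (diff beta (v - 1)))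
           (Pp (alpha (u + 1))) (Pp (alpha (u - 1)))).

End DIAMS.

(* Main.v *)
Require Import Defs.
From HB Require Import structures.
From mathcomp Require Import all_boot all_order all_algebra.
From mathcomp Require Import classical_sets reals.
From mathcomp Require Import ring lra zify.

Import Order.TTheory GRing.Theory Num.Theory.
Local Open Scope ring_scope.

(* At an inner vertex (u, v) put n = alpha u - beta v.  Adding multiples of the
   other columns turns the four neighbouring values of Omega into [n, x, y],
   where x is alpha'(u +- 1/2) and y is beta'(v +- 1/2); by (G) none of them
   vanishes.  An edge at (u, v) is singular iff Omega changes sign across it, so
   going around the vertex the number of singular edges is even: 0, 2 or 4.  If
   it is 4, Cramer's rule in the basis n, alpha'(u + 1/2), alpha'(u - 1/2) shows
   that the projections of beta (v + 1) and beta (v - 1) have coordinates of the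
   same signs, i.e. lie in the same quadrant, against (H). *)

Section Det3.
Variable R : realType.
Implicit Types a b c d x y z : 'rV[R]_3.

Lemma det3E a b c : det3 a b c =
  let i := inord 1 : 'I_3 in let j := inord 2 : 'I_3 in
  a 0 0 * (b 0 i * c 0 j - b 0 j * c 0 i)
  - a 0 i * (b 0 0 * c 0 j - b 0 j * c 0 0)
  + a 0 j * (b 0 0 * c 0 i - b 0 i * c 0 0).
Proof.
(* Indexing coordinates by naturals turns the differently built ordinals of the expansions into
   equal atoms for [ring]. *)
have [coord coordE] : exists g : 'rV[R]_3 -> nat -> R, forall x k, x 0 k = g x k.
  by exists (fun x k => x 0 (inord k)) => x k; rewrite inord_val.
rewrite /det3 (expand_det_row _ ord0) !big_ord_recl big_ord0 /cofactor.
rewrite !(expand_det_row _ ord0) !big_ord_recl !big_ord0 /cofactor !det_mx11.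
rewrite !mxE /= !coordE /= !inordK //= /bump /=.
ring.
Qed.

Lemma det3_cramer d a b x : det3 d a b != 0 ->
  x = (det3 x a b / det3 d a b) *: d + (det3 d x b / det3 d a b) *: a
      + (det3 d a x / det3 d a b) *: b.
Proof.
move=> Dn0; apply/rowP => k; rewrite !mxE.
(* With denominators cleared, each coordinate gives a polynomial identity: a 4 x 4 determinant with
   a repeated row vanishes. *)
suff E : det3 d a b * x 0 k
    = det3 x a b * d 0 k + det3 d x b * a 0 k + det3 d a x * b 0 k.
  by apply: (mulfI Dn0); rewrite E; field.
have /or3P[/eqP->|/eqP->|/eqP->] : [|| k == 0, k == inord 1 | k == inord 2].
- by case: k => [[|[|[|k]]] //= Hk]; rewrite -!val_eqE /= !inordK.
all: rewrite !det3E /=; ring.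
Qed.

(** A nonzero kernel vector of the matrix supplies the coefficients of a linear dependence. *)
Lemma det3_eq0_nfree d x y : det3 d x y = 0 -> ~~ free [:: d; x; y].
Proof.
move=> /eqP/det0P[v vn0 /rowP vA]; apply: contra vn0.
move=> /(@freeP _ _ 3 [tuple d; x; y]) fr; apply/eqP/rowP => i; rewrite mxE.
apply: (fr (v 0)); apply/rowP => k; apply: etrans (vA k).
by rewrite summxE [RHS]mxE; apply: eq_bigr => j _; rewrite !mxE.
Qed.

(** Both spans have dimension 2, so one inclusion is enough; if [y] lay outside the span of [d] and
    [x], the three vectors would be free. *)
Lemma span_eq_det3 d x y : det3 d x y = 0 ->
  free [:: d; x] -> free [:: d; y] -> <<[:: d; x]>>%VS = <<[:: d; y]>>%VS.
Proof.
move=> /det3_eq0_nfree nf fx fy; apply/eqP; rewrite eq_sym eqEdim.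
have [/eqP -> /eqP ->] : free [:: d; y] /\ free [:: d; x] by [].
rewrite leqnn andbT; apply/span_subvP => z; rewrite !inE => /orP[]/eqP->.
  by rewrite memv_span // mem_head.
apply: contraNT nf => ynin.
have /perm_free -> : perm_eq [:: d; x; y] [:: y; d; x].
  by rewrite (perm_catC [:: d; x] [:: y]).
by rewrite free_cons ynin.
Qed.

End Det3.

Lemma same_quadrant_comb (R : realType) (d1 d2 : 'rV[R]_3) (s s' t t' : R) :
  0 < s * s' -> 0 < t * t' ->
  same_quadrant d1 d2 (s *: d1 + t *: d2) (s' *: d1 + t' *: d2).
Proof.
have sgn_same (p q : R) : 0 < p * q -> exists b : bool, exists p' q' : R,
    [/\ 0 < p', 0 < q', p = (-1) ^+ b * p' & q = (-1) ^+ b * q'].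
  case: (ltrgt0P p) => [p0|p0|->] pq; last by rewrite mul0r ltxx in pq.
    by exists false, p, q; split; rewrite ?expr0; nra.
  by exists true, (- p), (- q); split; rewrite ?expr1; nra.
move=> /sgn_same[e1 [p [p' [hp hp' -> ->]]]] /sgn_same[e2 [q [q' [hq hq' -> ->]]]].
by exists e1, e2; split; [exists p, q | exists p', q'].
Qed.

(** [inner_vertex] only places the neighbouring indices in [I] and [J]; convexity adds the index
    itself. *)
Lemma itv_int_mid (I : interval int) (k : int) :
  k - 1 \in I -> k + 1 \in I -> k \in I.
Proof.
by case: I => [[[] l|[]] [[] r|[]]]; rewrite !in_itv /= ?andbT ?andbF //; lia.
Qed.

Lemma projv_nu_comb (R : realType) (alpha beta : int -> 'rV[R]_3)
    (W : {vspace 'rV[R]_3}) (u v : int) (c s t : R) (a b : 'rV[R]_3) :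
  transversal_plane alpha beta W u v ->
  projv_nu alpha beta W u v (c *: nu alpha beta u v + s *: a + t *: b)
  = s *: projv_nu alpha beta W u v a + t *: projv_nu alpha beta W u v b.
Proof.
move=> [_ nuW]; rewrite /projv_nu; move: (nu alpha beta u v) nuW => n nuW.
have Wn0 : (W :&: <[n]> = 0)%VS.
  apply/eqP; rewrite -subv0; apply/subvP => x; rewrite memv_cap memv0.
  move=> /andP[xW /vlineP[k xE]]; move: xW; rewrite xE rpredZeq (negPf nuW) orbF.
  by move=> /eqP ->; rewrite scale0r.
have nV : n \in <[n]>%VS by exact: memv_line.
(* The two components of [n] add up to [n] and the second is already [n], so the projection onto [W]
   kills [n]. *)
have := daddv_pi_add Wn0 (subvP (addvSr W _) n nV).
rewrite [X in _ + X]daddv_pi_id 1?capvC // => pin.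
have pn0 : daddv_pi W <[n]>%VS n = 0 by apply: (addIr n); rewrite add0r.
by rewrite !linearD !linearZ /= pn0 scaler0 add0r.
Qed.

Section Generic.
Variables (R : realType) (I J : interval int) (alpha beta : int -> 'rV[R]_3).

(** A zero determinant would give the two planes of (G) the same direction, and they share the point
    [alpha u]. *)
Lemma hypG_det3_neq0 (u v : int) (k l : neighbour) :
  hypG I J alpha beta -> u \in I -> v \in J ->
  neighbour_exists I J u v k -> neighbour_exists I J u v l -> k <> l ->
  det3 (beta v - alpha u) (neighbour_point alpha beta u v k - alpha u)
    (neighbour_point alpha beta u v l - alpha u) != 0.
Proof.
move=> hG uI vJ hk hl kl; have [_ hdef hdist] := hG u v uI vJ.
apply/eqP => /span_eq_det3 E; apply: (hdist k l hk hl kl).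
by rewrite /plane_through /plane_dir E //; exact: hdef.
Qed.

(** The first four determinants are the values of [Omega] around the vertex; the fifth makes the
    projections of [a] and [a'] along [n] independent. *)
Definition diffs_generic (n a a' b b' : 'rV[R]_3) : Prop :=
  [/\ det3 n a b != 0, det3 n a b' != 0, det3 n a' b != 0,
      det3 n a' b' != 0 & det3 n a a' != 0].

Lemma hypG_diffs_generic (u v : int) :
  hypG I J alpha beta -> inner_vertex I J u v ->
  diffs_generic (nu alpha beta u v) (diff alpha u) (diff alpha (u - 1))
    (diff beta v) (diff beta (v - 1)).
Proof.
move=> hG /and4P[uI1 uI2 vJ1 vJ2].
have G k l := hypG_det3_neq0 u v k l hG (itv_int_mid _ _ uI1 uI2)
  (itv_int_mid _ _ vJ1 vJ2).
rewrite /nu /diff !subrK.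
split; [move: (G AlphaNext BetaNext uI2 vJ2) | move: (G AlphaNext BetaPrev uI2 vJ1)
  | move: (G AlphaPrev BetaNext uI1 vJ2) | move: (G AlphaPrev BetaPrev uI1 vJ1)
  | move: (G AlphaNext AlphaPrev uI2 uI1)] => /(_ ltac:(done)) /=;
  apply: contraNneq; rewrite !det3E /= !mxE => E; apply/eqP; lra.
Qed.

Lemma Omega_prevl (u v : int) :
  Omega alpha beta (u - 1) v
  = det3 (nu alpha beta u v) (diff alpha (u - 1)) (diff beta v).
Proof. by rewrite /Omega /nu /diff subrK !det3E /= !mxE; ring. Qed.

Lemma Omega_prevr (u v : int) :
  Omega alpha beta u (v - 1)
  = det3 (nu alpha beta u v) (diff alpha u) (diff beta (v - 1)).
Proof. by rewrite /Omega /nu /diff subrK !det3E /= !mxE; ring. Qed.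

Lemma Omega_prevlr (u v : int) :
  Omega alpha beta (u - 1) (v - 1)
  = det3 (nu alpha beta u v) (diff alpha (u - 1)) (diff beta (v - 1)).
Proof. by rewrite Omega_prevr /nu /diff !subrK !det3E /= !mxE; ring. Qed.

(** Over the basis [n], [a], [a'], the coordinates of [b] and [b'] along [a] and [a'] are, up to
    sign, values of [Omega] over a common denominator. The minus sign in
    [beta (v - 1) = beta v - b'] turns the sign changes of [Omega] into equal signs of
    coordinates. *)
Lemma same_quadrant_alternating (W : {vspace 'rV[R]_3}) (u v : int) :
  let Pv := projv_nu alpha beta W u v in
  let Pp := projp_nu alpha beta W u v in
  transversal_plane alpha beta W u v ->
  det3 (nu alpha beta u v) (diff alpha u) (diff alpha (u - 1)) != 0 ->
  Omega alpha beta (u - 1) (v - 1) * Omega alpha beta (u - 1) v < 0 ->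
  Omega alpha beta u (v - 1) * Omega alpha beta u v < 0 ->
  same_quadrant (Pv (diff alpha u)) (Pv (diff alpha (u - 1)))
    (Pp (beta (v - 1))) (Pp (beta (v + 1))).
Proof.
move=> Pv Pp hW Dn0; rewrite Omega_prevlr Omega_prevr Omega_prevl /Omega -/(nu _ _ u v).
move: Dn0; set n := nu _ _ _ _; set a := diff _ _; set a' := diff alpha (u - 1).
set b := diff beta v; set b' := diff beta (v - 1) => Dn0 h1 h2.
have PpE (x w : 'rV[R]_3) : x = beta v + w -> Pp x =
    (det3 n w a' / det3 n a a') *: Pv a + (det3 n a w / det3 n a a') *: Pv a'.
  (* The [- 1] comes from [beta v - alpha u = - n]. *)
  move=> ->; rewrite /Pp /projp_nu -(projv_nu_comb _ _ _ _ _ _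
    (det3 w a a' / det3 n a a' - 1)) //; congr (projv_nu _ _ _ _ _ _).
  have -> : beta v + w - alpha u = w - n by rewrite opprB addrCA addrA.
  rewrite -/n [X in X - n = _](det3_cramer _ _ _ _ w Dn0) scalerBl scale1r.
  by rewrite -!addrA; congr (_ + _); rewrite addrA addrC.
have prevE : beta (v - 1) = beta v - b' by rewrite /b' /diff subrK subKr.
have nextE : beta (v + 1) = beta v + b by rewrite /b /diff subrKC.
rewrite (PpE _ _ prevE) (PpE _ _ nextE).
(* In a product of two coordinates the common denominator enters only through its positive
   square. *)
have D2 : 0 < (det3 n a a') ^-2 by rewrite invr_gt0 exprn_even_gt0.
apply: same_quadrant_comb.
  suff -> : det3 n (- b') a' / det3 n a a' * (det3 n b a' / det3 n a a')
      = - (det3 n a' b' * det3 n a' b) * (det3 n a a') ^-2.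
    by rewrite mulr_gt0 // oppr_gt0.
  have -> : det3 n (- b') a' = det3 n a' b' by rewrite !det3E /= !mxE; ring.
  have -> : det3 n b a' = - det3 n a' b by rewrite !det3E /=; ring.
  by field.
suff -> : det3 n a (- b') / det3 n a a' * (det3 n a b / det3 n a a')
    = - (det3 n a b' * det3 n a b) * (det3 n a a') ^-2.
  by rewrite mulr_gt0 // oppr_gt0.
have -> : det3 n a (- b') = - det3 n a b' by rewrite !det3E /= !mxE; ring.
by field.
Qed.

End Generic.

(** Makes singularity of an edge a boolean xor, so that counting singular edges becomes a finite
    case analysis. *)
Lemma prod_lt0_sign (R : realDomainType) (x y : R) : x != 0 -> y != 0 ->
  (x * y < 0) = (x < 0) (+) (y < 0).
Proof.
move=> x0 y0; case: (ltrgt0P x) x0 => // x_sgn _.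
  by rewrite pmulr_rlt0.
by rewrite nmulr_rlt0 // ltNge le_eqVlt (negPf y0).
Qed.

Theorem proposition4p2 (R : realType) (I J : interval int)
    (alpha beta : int -> 'rV[R]_3) (f : int -> int -> 'rV[R]_3)
    (pi : int -> int -> {vspace 'rV[R]_3})
    (hf : is_DIAMS I J alpha beta f)
    (hG : hypG I J alpha beta)
    (hpi : forall u v : int, inner_vertex I J u v ->
       transversal_plane alpha beta (pi u v) u v)
    (hH : hypH I J alpha beta pi)
    (u0 v0 : int) (hin : inner_vertex I J u0 v0)
    (hsing : singular_vertex I J alpha beta u0 v0) :
  exists e1 e2 : edge, e1 <> e2 /\
    forall e : edge,
      (singular_edge I J alpha beta e /\ endpoint e u0 v0) <->
      (e = e1 \/ e = e2).
Proof.
have [hpp hpm hmp hmm hD] := hypG_diffs_generic _ _ _ _ _ _ _ hG hin.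
rewrite -Omega_prevr in hpm; rewrite -Omega_prevl in hmp.
rewrite -Omega_prevlr in hmm; rewrite -/(Omega alpha beta u0 v0) in hpp.
have [hHa _] := hH _ _ hin.
have alt := same_quadrant_alternating _ _ _ _ _ _ (hpi _ _ hin) hD.
have [uI1 uI2 vJ1 vJ2] := and4P hin.
have uI := itv_int_mid _ _ uI1 uI2; have vJ := itv_int_mid _ _ vJ1 vJ2.
set wpp := Omega alpha beta u0 v0 in hpp alt.
set wpm := Omega alpha beta u0 (v0 - 1) in hpm alt.
set wmp := Omega alpha beta (u0 - 1) v0 in hmp alt.
set wmm := Omega alpha beta (u0 - 1) (v0 - 1) in hmm alt.
(* All four quadrangles at an inner vertex exist, so only the sign condition on [Omega] decides
   singularity. *)
have quads : [/\ is_quad I J u0 v0, is_quad I J u0 (v0 - 1),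
    is_quad I J (u0 - 1) v0 & is_quad I J (u0 - 1) (v0 - 1)].
  by rewrite /is_quad !subrK uI uI1 uI2 vJ vJ1 vJ2.
have [qpp qpm qmp qmm] := quads.
have Vnext : singular_edge I J alpha beta (VEdge u0 v0)
    <-> (wmp < 0) (+) (wpp < 0).
  by rewrite -prod_lt0_sign //; split=> [[]|?] //; split.
have Vprev : singular_edge I J alpha beta (VEdge u0 (v0 - 1))
    <-> (wmm < 0) (+) (wpm < 0).
  by rewrite -prod_lt0_sign //; split=> [[]|?] //; split.
have Unext : singular_edge I J alpha beta (UEdge u0 v0)
    <-> (wpm < 0) (+) (wpp < 0).
  by rewrite -prod_lt0_sign //; split=> [[]|?] //; split.
have Uprev : singular_edge I J alpha beta (UEdge (u0 - 1) v0)
    <-> (wmm < 0) (+) (wmp < 0).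
  by rewrite -prod_lt0_sign //; split=> [[]|?] //; split.
have star e : singular_edge I J alpha beta e /\ endpoint e u0 v0 <->
    [\/ (wmp < 0) (+) (wpp < 0) /\ e = VEdge u0 v0,
        (wmm < 0) (+) (wpm < 0) /\ e = VEdge u0 (v0 - 1),
        (wpm < 0) (+) (wpp < 0) /\ e = UEdge u0 v0
      | (wmm < 0) (+) (wmp < 0) /\ e = UEdge (u0 - 1) v0].
  split; last first.
    case=> -[s ->].
    - by split; [apply/Vnext | split=> //; left].
    - by split; [apply/Vprev | split=> //; right; rewrite subrK].
    - by split; [apply/Unext | split=> //; left].
    - by split; [apply/Uprev | split=> //; right; rewrite subrK].
  case: e => u v /= [s [h1 h2]].
  - case: h1 => h1; subst u0 v0.
      by constructor 3; split=> //; apply/Unext.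
    by rewrite addrK in Uprev *; constructor 4; split=> //; apply/Uprev.
  - case: h2 => h2; subst u0 v0.
      by constructor 1; split=> //; apply/Vnext.
    by rewrite addrK in Vprev *; constructor 2; split=> //; apply/Vprev.
(* By parity these three xors force the fourth, so this excludes four singular edges. The second one
   triggers (H); the other two feed [alt]. *)
have not_alt : ~ [&& (wmm < 0) (+) (wmp < 0), (wmp < 0) (+) (wpp < 0)
    & (wpm < 0) (+) (wpp < 0)].
  move=> /and3P[s1 s2 s3]; apply: hHa; first by left; apply/Vnext.
  by apply: alt; rewrite prod_lt0_sign //.
have some_sing : [|| (wmm < 0) (+) (wmp < 0), (wmp < 0) (+) (wpp < 0),
    (wpm < 0) (+) (wpp < 0) | (wmm < 0) (+) (wpm < 0)].
  by have [e /star[][-> _]] := hsing; rewrite ?orbT.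
have ne1 (k : int) : k <> k - 1 by clear; lia.
move: star not_alt some_sing.
(* Of the 16 sign patterns, [some_sing] removes the two constant ones and [not_alt] the two
   alternating ones. *)
case: (wmm < 0); case: (wmp < 0); case: (wpm < 0); case: (wpp < 0) => //=;
  move=> star not_alt _.
(* In each of the 12 remaining patterns exactly two xors in [star] are true, and their edges are the
   witnesses. *)
all: match type of star with forall e, _ <-> or4 (is_true ?a /\ _ = ?A) (is_true ?b /\ _ = ?B)
         (is_true ?c /\ _ = ?C) (is_true ?d /\ _ = ?D) =>
  match eval compute in (a, b, c, d) with
  | (true, true, false, false) => exists A, B
  | (true, false, true, false) => exists A, C
  | (true, false, false, true) => exists A, D
  | (false, true, true, false) => exists B, C
  | (false, true, false, true) => exists B, D
  | (false, false, true, true) => exists C, D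
  end end.
all: split; first by [| case=> /ne1].
all: move=> e; rewrite star; split; last by case=> ->;
  first [by constructor 1 | by constructor 2 | by constructor 3 | by constructor 4].
all: by case=> -[] //; auto.
Qed.
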